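(* Consider the ensemble $\mathcal C$ of bipartite-graph codes $C(G;A,A)$ of length $N=n\Delta$ and rate $R$, with $n\to\infty$ and $\Delta$ constant, where $G$ is a random $\Delta$-regular bipartite graph with $n$ vertices in each part and $A$ is a random binary linear code of length $\Delta$ and dimension $R_0\Delta$. If the distance of the code $A$ is at least $3$, then the ensemble-average relative distance is bounded away from zero (i.e., the ensemble $\mathcal C$ contains asymptotically good codes).
   Context: Bipartite-graph code: let $G=(V_0\cup V_1,E)$ be a $\Delta$-regular bipartite graph with $|V_0|=|V_1|=n$ and $N=n\Delta$ edges, whose edges are put in a fixed order (which induces an order on the edges incident to each vertex). Let $A$ be a binary linear code of length $\Delta$ and rate $R_0$. The code $C(G;A,A)$ is the set of $\mathbf x\in\{0,1\}^N$ (coordinates indexed by the edges) such that for every vertex $v\in V_0\cup V_1$ the projection $\mathbf x_v$ of $\mathbf x$ on the edges incident to $v$ is a codeword of $A$. Its rate $R$ satisfies $R\ge 2R_0-1$. The relative distance of a code of length $N$ is its minimum distance divided by $N$. Random ensemble: let $H$ be a $\Delta(1-R_0)\times\Delta$ parity-check matrix of $A$, let $\mathcal H_1$ be the block-diagonal matrix with $n$ copies of $H$ on the diagonal, and let $\mathcal H_2=\pi(\mathcal H_1)$ be obtained from $\mathcal H_1$ by a permutation $\pi$ of its $N$ columns (defined by the edges of $G$). The code $C(G;A,A)$ has the parity-check matrix formed by stacking $\mathcal H_1$ on top of $\mathcal H_2$. In the ensemble, $H$ is a random binary matrix with uniform distribution and $\pi$ is uniformly distributed over all permutations of $N$ elements;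 the statement concerns the case when the local code $A$ has minimum distance at least $3$. Asymptotically good codes here means codes, with $n\to\infty$, whose relative distance is bounded away from zero. *)

(* Defs.v *)
(* MathComp world. *)
From HB Require Import structures.
From mathcomp Require Import all_boot all_order all_fingroup all_algebra.
From mathcomp Require Import mxtens.

Set Implicit Arguments.
Unset Strict Implicit.
Unset Printing Implicit Defensive.

Import Order.TTheory GRing.Theory Num.Theory.
Local Open Scope ring_scope.

Definition hamming_dist (N : nat) (x y : 'rV['F_2]_N) : nat :=
  #|[set i | x 0 i != y 0 i]|.

(* The default value N is never attained spuriously: distances are at most N,
   so for a code with two distinct words this is the true minimum; a code with
   at most one word gets distance N. *)
Definition min_dist (N : nat) (C : {set 'rV['F_2]_N}) : nat :=
  \big[minn/N]_(p in setX C C | p.1 != p.2) hamming_dist p.1 p.2.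

Definition rel_dist (N : nat) (C : {set 'rV['F_2]_N}) : rat :=
  (min_dist C)%:R / N%:R.

Definition local_code (m D : nat) (H : 'M['F_2]_(m, D)) : {set 'rV['F_2]_D} :=
  [set a | H *m a^T == 0].

Definition local_dim (m D : nat) (H : 'M['F_2]_(m, D)) : nat :=
  \rank (kermx H^T).

(* A D-regular bipartite (multi)graph with parts V_0, V_1 of size n and with
   edge set 'I_(n * D) is given by its incidence lists: [inc s v i] is the i-th
   edge at the vertex v of V_s (s = false for V_0, s = true for V_1). *)
Definition incidence (n D : nat) : Type := bool -> 'I_n -> 'I_D -> 'I_(n * D).

Definition vertex_proj (n D : nat) (inc : incidence n D) (s : bool) (v : 'I_n)
    (x : 'rV['F_2]_(n * D)) : 'rV['F_2]_D :=
  \row_i x 0 (inc s v i).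

Definition bipartite_code (n D : nat) (inc : incidence n D)
    (A : {set 'rV['F_2]_D}) : {set 'rV['F_2]_(n * D)} :=
  [set x | [forall s : bool, forall v : 'I_n, vertex_proj inc s v x \in A]].

(* [mxtens_index (v, i)] is v * D + i. The vertex v of V_0 meets the D
   consecutive edges v * D, ..., v * D + D - 1, and the vertex v of V_1 meets
   the images of these under pi, in that order. Parallel edges can occur. *)
Definition perm_incidence (n D : nat) (pi : 'S_(n * D)) : incidence n D :=
  fun s v i => if s then pi (mxtens_index (v, i)) else mxtens_index (v, i).

Lemma perm_incidence_bij (n D : nat) (pi : 'S_(n * D)) (s : bool) :
  bijective (fun vi : 'I_n * 'I_D => perm_incidence pi s vi.1 vi.2).
Proof.
have bij : bijective (@mxtens_index n D).
  exact: (Bijective (@mxtens_indexK n D) (@mxtens_unindexK n D)).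
case: s; last by apply: (eq_bij bij) => -[].
apply: (eq_bij (f := pi \o @mxtens_index n D)); last by case.
exact: bij_comp (injF_bij perm_inj) bij.
Qed.

Definition graph_code (m n D : nat) (H : 'M['F_2]_(m, D)) (pi : 'S_(n * D)) :
    {set 'rV['F_2]_(n * D)} :=
  bipartite_code (perm_incidence pi) (local_code H).

(* [1%:M *t H] is the block-diagonal matrix with n copies of H; the column c of
   [col_perm pi^-1 M] is the column pi^-1 c of M, i.e. pi moves the column c of
   M to the position pi c. *)
Lemma graph_code_parity_check (m n D : nat) (H : 'M['F_2]_(m, D))
    (pi : 'S_(n * D)) (H1 := (1%:M : 'M['F_2]_n) *t H) :
  graph_code H pi = [set x | col_mx H1 (col_perm pi^-1%g H1) *m x^T == 0].
Proof.
have E (y : 'cV['F_2]_(n * D)) (v : 'I_n) (r : 'I_m) :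
    (H1 *m y) (mxtens_index (v, r)) 0
    = \sum_i H r i * y (mxtens_index (v, i)) 0.
  rewrite mxE (reindex (@mxtens_index n D)) /=; last first.
    apply: onW_bij.
    exact: (Bijective (@mxtens_indexK n D) (@mxtens_unindexK n D)).
  rewrite (eq_bigr (fun p : 'I_n * 'I_D =>
     (fun u i => (v == u)%:R * H r i * y (mxtens_index (u, i)) 0) p.1 p.2));
    last by case=> u i _; rewrite tensmxE mxE.
  rewrite -(pair_bigA _ (fun u i =>
    (v == u)%:R * H r i * y (mxtens_index (u, i)) 0)) /= (bigD1 v) //= eqxx.
  rewrite [X in _ + X]big1 ?addr0 => [|u /negPf uv].
    by apply: eq_bigr => i _; rewrite mul1r.
  by rewrite big1 // => i _; rewrite eq_sym uv !mul0r.
have Z (y : 'cV['F_2]_(n * D)) :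
    (H1 *m y == 0) = [forall v : 'I_n,
       H *m (\row_i y (mxtens_index (v, i)) 0)^T == 0].
  have F v r : (H *m (\row_i y (mxtens_index (v, i)) 0)^T) r 0
      = (H1 *m y) (mxtens_index (v, r)) 0.
    by rewrite E mxE; apply: eq_bigr => i _; rewrite !mxE.
  apply/eqP/forallP => [y0 v|y0].
    by apply/eqP/colP => r; rewrite F y0 !mxE.
  apply/colP => k; case: (mxtens_indexP k) => v r.
  by rewrite -F (eqP (y0 v)) !mxE.
have P (x : 'rV['F_2]_(n * D)) :
    col_perm pi^-1%g H1 *m x^T = H1 *m (\col_c x 0 (pi c)).
  apply/colP => k; rewrite !mxE (reindex_inj (@perm_inj _ pi)) /=.
  by apply: eq_bigr => c _; rewrite !mxE permK.
apply/setP => x; rewrite !inE mul_col_mx col_mx_eq0 P !Z.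
apply/forallP/andP => [inA|[/forallP inA0 /forallP inA1] s].
  split; apply/forallP => v.
    have /forallP/(_ v) := inA false; rewrite inE.
    by congr (_ *m _ == 0); apply/colP => i; rewrite !mxE.
  have /forallP/(_ v) := inA true; rewrite inE.
  by congr (_ *m _ == 0); apply/colP => i; rewrite !mxE.
apply/forallP => v; rewrite inE; case: s.
  by have := inA1 v; congr (_ *m _ == 0); apply/colP => i; rewrite !mxE.
by have := inA0 v; congr (_ *m _ == 0); apply/colP => i; rewrite !mxE.
Qed.

(* Parity-check matrices of the local codes of length D and dimension k (so
   R_0 = k / D and H has (1 - R_0) D = D - k rows) with distance at least d. *)
Definition local_checks (D k d : nat) : {set 'M['F_2]_(D - k, D)} :=
  [set H | (local_dim H == k) && (d <= min_dist (local_code H))%N].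

(* Sample space of the ensemble, with the uniform distribution: H and pi are
   independent and uniform on local_checks D k d and on all permutations. *)
Definition ensemble (D k d n : nat) :
    {set 'M['F_2]_(D - k, D) * 'S_(n * D)} :=
  setX (local_checks D k d) setT.

Definition ensemble_avg_rel_dist (D k d n : nat) : rat :=
  (\sum_(w in ensemble D k d n) rel_dist (graph_code w.1 w.2))
  / #|ensemble D k d n|%:R.

(* Main.v *)
Require Import Defs.
From mathcomp Require Import all_boot all_order all_fingroup all_algebra.
From mathcomp Require Import primitive_action alt mxtens zify ring lra.

Import Order.TTheory GRing.Theory Num.Theory.
Local Open Scope ring_scope.

(* Fix H with local distance at least 3. In the support of a word all of whose
   blocks are local codewords, each block is empty or has at least 3 edges; so
   at most t = w %/ 3 blocks are hit when the weight is w, and there are at most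
   B_w = 'C(n, t) * 2 ^ (t * D) such supports. A uniform permutation maps a
   given w-set to another given one with probability 1 / 'C(N, w), so a code
   word of weight w exists with probability at most B_w ^ 2 / 'C(N, w). Up to
   factors c ^ w this is (w / N) ^ (w - 2 t), with w - 2 t >= w / 3, hence it is
   at most 4 ^- w as soon as w <= N / M with M large in terms of D only. Summing
   over w >= 1, at least 2/3 of the permutations give relative distance at least
   1 / M. *)

(** * Uniform permutations acting on sets of fixed size *)

(** The symmetric group is [#|X|]-transitive; apply this to duplicate-free enumerations of [X] and
    [Y]. *)
Lemma perm_imset_exists (T : finType) (X Y : {set T}) :
  #|X| = #|Y| -> exists s : {perm T}, s @: X = Y.
Proof.
move=> eXY.
have le : (#|X| <= #|T|)%N by exact: max_card.
have tr := ntransitive_weak le (Sym_trans T).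
pose tX : #|X|.-tuple T := enum_tuple (mem X).
have sY : size (enum Y) == #|X| by rewrite -cardE eXY.
pose tY : #|X|.-tuple T := Tuple sY.
have dX : tX \in dtuple_on #|X| [set: T].
  by rewrite inE enum_uniq; apply/subsetP=> x; rewrite inE.
have dY : tY \in dtuple_on #|X| [set: T].
  by rewrite inE enum_uniq; apply/subsetP=> x; rewrite inE.
have [s _ E] := atransP2 tr dX dY.
exists s; apply/setP => y.
have := congr1 val E; rewrite /= => {}E.
by rewrite -[y \in Y]mem_enum E; apply/imsetP/mapP => -[x xX ->]; exists x;
  move: xX; rewrite ?mem_enum.
Qed.

(** Right multiplication by a permutation taking [Y1] to [Y2] injects one fibre of [s |-> s @: X]
    into another, so all ['C(#|T|, #|X|)] fibres have the same size. *)
Lemma card_perm_imset (T : finType) (X Y : {set T}) : #|X| = #|Y| ->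
  (#|[set s : {perm T} | s @: X == Y]| * 'C(#|T|, #|X|) = #|T|`!)%N.
Proof.
move=> eXY; pose f Z := #|[set s : {perm T} | s @: X == Z]|.
have le (Y1 Y2 : {set T}) : #|Y1| = #|Y2| -> (f Y1 <= f Y2)%N.
  move=> /perm_imset_exists[a aY].
  rewrite /f -(card_imset _ (mulIg a));
  apply/subset_leq_card/subsetP => b /imsetP[s]; rewrite !inE => /eqP sX ->{b}.
  rewrite -aY -sX -imset_comp; apply/eqP/eq_imset => x.
  by rewrite permM.
rewrite -card_draws mulnC -sum_nat_const -card_Sym.
rewrite -[RHS]sum1_card.
rewrite (partition_big (fun s : {perm T} => s @: X)
  (fun Z => Z \in [set A : {set T} | #|A| == #|X|])) /=; last first.
  by move=> s _; rewrite inE card_imset //; exact: perm_inj.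
apply: eq_bigr => Z; rewrite inE => /eqP eZ; rewrite sum1_card.
transitivity (f Z); first by apply/eqP; rewrite eqn_leq !le // eZ.
by rewrite /f; apply: eq_card => s; rewrite inE unfold_in inE.
Qed.

Lemma leq_card_bigcup (I T : finType) (P : pred I) (F : I -> {set T}) :
  (#|\bigcup_(i | P i) F i| <= \sum_(i | P i) #|F i|)%N.
Proof.
elim/big_rec2: _ => [|i m A _ le]; first by rewrite cards0.
by apply: leq_trans (leq_card_setU _ _) _; rewrite leq_add2l.
Qed.

(** Union bound over the pairs of members of [F], each pair having probability [1 / 'C(#|T|, w)]. *)
Lemma card_perm_hits (T : finType) (F : {set {set T}}) (w : nat) :
  {in F, forall X : {set T}, #|X| = w} ->
  (#|[set s : {perm T} | [exists X in F, s @: X \in F]]| * 'C(#|T|, w)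
     <= #|F| ^ 2 * #|T|`!)%N.
Proof.
move=> Fw.
pose S (p : {set T} * {set T}) := [set s : {perm T} | s @: p.1 == p.2].
have sub : [set s : {perm T} | [exists X in F, s @: X \in F]]
    \subset \bigcup_(p in setX F F) S p.
  apply/subsetP => s; rewrite inE => /existsP[X /andP[XF sXF]].
  by apply/bigcupP; exists (X, s @: X); rewrite ?inE ?XF //=.
apply: leq_trans (leq_mul (subset_leq_card sub) (leqnn _)) _.
apply: leq_trans (leq_mul (leq_card_bigcup _ _ _ _) (leqnn _)) _.
rewrite big_distrl /= -mulnn -cardsX -sum_nat_const.
apply: leq_sum => -[X Y]; rewrite inE /= => /andP[XF YF].
by rewrite -(Fw X XF) card_perm_imset // (Fw X) ?(Fw Y).
Qed.

(** * Binomial estimates *)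

Lemma bin_mul_expn_leq (n t : nat) : ('C(n, t) * t ^ t <= (4 * n) ^ t)%N.
Proof.
have ffle (m k : nat) : (m ^_ k <= m ^ k)%N.
  rewrite ffact_prod -[X in (_ <= _ ^ X)%N](card_ord k) -prod_nat_const.
  by apply: leq_prod => i _; exact: leq_subr.
(* t ^ t <= t`! * 'C(2 t, t) and 'C(2 t, t) <= 4 ^ t *)
have tt : (t ^ t <= t.*2 ^_ t)%N.
  rewrite ffact_prod -[X in (_ ^ X <= _)%N](card_ord t) -prod_nat_const.
  by apply: leq_prod => i _; rewrite -addnn -addnBA ?leq_addr // ltnW.
have C2 : ('C(t.*2, t) <= 4 ^ t)%N.
  rewrite (_ : 4 = 2 ^ 2)%N // -expnM mul2n.
  have -> : (2 ^ t.*2 = \sum_(i < t.*2.+1) 'C(t.*2, i))%N.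
    by rewrite -[2%N]/(1 + 1)%N expnDn; apply: eq_bigr => i _;
      rewrite !exp1n !muln1.
  have lt : (t < t.*2.+1)%N by rewrite ltnS -addnn leq_addr.
  by rewrite (bigD1 (Ordinal lt)) //= leq_addr.
(* The factor t! passes from [t.*2 ^_ t] to ['C(n, t)], which leaves ['C(t.*2, t) * n ^_ t]. *)
apply: leq_trans (leq_mul (leqnn _) tt) _.
by rewrite -(bin_ffact t.*2) mulnCA bin_ffact expnMn leq_mul.
Qed.

(** Factor by factor, [N / w <= (N - i) / (w - i)] for [i < w]. *)
Lemma expn_leq_bin (N w : nat) : (w <= N)%N -> (N ^ w <= 'C(N, w) * w ^ w)%N.
Proof.
move=> wN; rewrite -(leq_pmul2r (fact_gt0 w)) mulnAC bin_ffact -ffactnn.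
have E m : (m ^ w = \prod_(i < w) m)%N by rewrite prod_nat_const card_ord.
rewrite !ffact_prod (E N) (E w) -!big_split /=.
apply: leq_prod => i _.
rewrite mulnBr mulnBl leq_sub2l //.
by rewrite mulnC leq_mul2r wN orbT.
Qed.

(** * Supports compatible with a local distance of at least 3 *)

(** The fibres of [p] are the edge sets of the vertices. Only the local distance 3 is retained from
    the code, so the family does not depend on [H]. *)
Definition block_supports (T V : finType) (p : T -> V) (w : nat) :
    {set {set T}} :=
  [set X : {set T} | (#|X| == w) &&
    [forall v, let m := #|X :&: p @^-1: [set v]| in ((m == 0) || (3 <= m))%N]].

Lemma subset_of_card (T : finType) (A : {set T}) (t : nat) :
  (#|A| <= t <= #|T|)%N -> exists2 B : {set T}, A \subset B & #|B| = t.
Proof.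
move=> /andP[At tT]; elim: t At tT => [|t IH].
  by rewrite leqn0 => /eqP A0 _; exists A.
rewrite leq_eqVlt => /orP[/eqP <- _|]; first by exists A.
rewrite ltnS => At tT; have [B AB Bt] := IH At (ltnW tT).
have [x xB] : exists x, x \in ~: B.
  by apply/set0Pn; rewrite -card_gt0 cardsCs setCK Bt subn_gt0.
exists (x |: B); first exact: subset_trans AB (subsetUr _ _).
by rewrite cardsU1 -in_setC xB Bt.
Qed.

(** Each fibre hit takes at least 3 points, so at most [w %/ 3] are hit. Pad them to exactly
    [w %/ 3] fibres, which needs that many in [V]; the support is then a subset of their union. *)
Lemma card_block_supports (T V : finType) (p : T -> V) (D w : nat) :
  (forall v, #|p @^-1: [set v]| = D) -> (w %/ 3 <= #|V|)%N ->
  (#|block_supports T V p w| <= 'C(#|V|, w %/ 3) * 2 ^ (w %/ 3 * D))%N.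
Proof.
move=> pD tV; set t := (w %/ 3)%N.
have fib (B : {set V}) : #|p @^-1: B| = (#|B| * D)%N.
  rewrite -sum1_card (partition_big p (mem B)) /=; last by move=> x; rewrite inE.
  rewrite -sum_nat_const; apply: eq_bigr => v vB.
  rewrite -(pD v) -sum1_card; apply: eq_bigl => x; rewrite !inE.
  by case: eqP => [->|]; rewrite ?vB ?andbF.
have sub : block_supports T V p w \subset
    \bigcup_(B in [set B : {set V} | #|B| == t]) powerset (p @^-1: B).
  apply/subsetP => X; rewrite inE => /andP[/eqP Xw /forallP Xb].
  have At : (#|p @: X| <= t)%N.
    rewrite leq_divRL // -Xw -[X in (_ <= X)%N]sum1_card.
    rewrite (partition_big p (mem (p @: X))) /=; last first.
      by move=> x xX; exact: imset_f.
    rewrite -sum_nat_const; apply: leq_sum => _ /imsetP[x xX ->].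
    have /= /orP[/eqP X0|X3] := Xb (p x).
      by have := cards0_eq X0 => /setP/(_ x); rewrite !inE xX eqxx.
    rewrite sum1_card; apply: leq_trans X3 _.
    by apply: eq_leq; apply: eq_card => y; rewrite !inE unfold_in.
  have [|B AB Bt] := subset_of_card _ (p @: X) t; first by rewrite At.
  apply/bigcupP; exists B; rewrite ?inE ?Bt //.
  by apply/subsetP => x xX; rewrite inE (subsetP AB) // imset_f.
apply: leq_trans (subset_leq_card sub) _.
apply: leq_trans (leq_card_bigcup _ _ _ _) _.
rewrite -card_draws -sum_nat_const; apply: leq_sum => B; rewrite inE => /eqP Bt.
by rewrite card_powerset fib Bt.
Qed.

Lemma block_supports_small (T V : finType) (p : T -> V) (w : nat) :
  (0 < w < 3)%N -> block_supports T V p w = set0.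
Proof.
move=> /andP[w0 w3]; apply/setP => X; rewrite !inE; apply/negP.
move=> /andP[/eqP Xw /forallP Xb].
have /set0Pn[x xX] : X != set0 by rewrite -card_gt0 Xw.
have /= /orP[/eqP X0|] := Xb (p x).
  by have := cards0_eq X0 => /setP/(_ x); rewrite !inE xX eqxx.
rewrite leqNgt => /negP[]; apply: leq_ltn_trans w3.
by rewrite -Xw subset_leq_card // subsetIl.
Qed.

(* With q = N / w and w <= 5 t, the left-hand side is at most
   (4 ^ 5 * (20 q) ^ 2 * 4 ^ D) ^ t and the right-hand side is at least
   q ^ (3 t); M is the resulting lower bound on q. *)
Lemma card_block_supports_sq_leq_bin (n D w M : nat) :
  M = (400 * 4 ^ (D + 5))%N ->
  (3 <= w)%N -> (0 < D)%N -> (M * w <= n * D)%N ->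
  (4 ^ w * ('C(n, w %/ 3) * 2 ^ (w %/ 3 * D)) ^ 2 <= 'C(n * D, w))%N.
Proof.
move=> ME w3 D0 Mw; set t := (w %/ 3)%N; set N := (n * D)%N.
have t0 : (0 < t)%N by rewrite divn_gt0.
have tw : (3 * t <= w)%N by rewrite mulnC leq_divM.
(* [w <= 3 * t + 2] and [1 <= t]; equality occurs at [w = 5]. *)
have wt : (w <= 5 * t)%N.
  rewrite /t in t0 *; have := ltn_ceil w (isT : (0 < 3)%N); lia.
have w0 : (0 < w)%N by exact: leq_trans w3.
pose q : rat := N%:R / w%:R.
have wR : (0 : rat) < w%:R by rewrite ltr0n.
have tR : (0 : rat) < t%:R by rewrite ltr0n.
have qM : M%:R <= q by rewrite /q ler_pdivlMr // -natrM ler_nat.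
have M0 : (0 < M)%N by rewrite ME muln_gt0 expn_gt0.
have q1 : 1 <= q by apply: le_trans qM; rewrite ler1n.
have q0 : 0 <= q by exact: le_trans q1.
have wN : (w <= N)%N by apply: leq_trans Mw; exact: leq_pmull.
have binN : q ^+ (3 * t) <= 'C(N, w)%:R.
  apply: (@le_trans _ _ (q ^+ w)); first exact: ler_weXn2l.
  rewrite expr_div_n ler_pdivrMr ?exprn_gt0 // -!natrX -natrM ler_nat.
  exact: expn_leq_bin.
(* Here 20 is 4 * 5: the 4 is from [bin_mul_expn_leq], the 5 from [w <= 5 * t]. *)
have binn : ('C(n, t)%:R : rat) <= (20%:R * q) ^+ t.
  apply: (@le_trans _ _ (((4 * n)%:R / t%:R : rat) ^+ t)).
    rewrite expr_div_n ler_pdivlMr ?exprn_gt0 // -!natrX -natrM ler_nat.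
    exact: bin_mul_expn_leq.
  have q20 : 0 <= 20%:R * q by rewrite mulr_ge0.
  rewrite lerXn2r ?nnegrE ?q20 ?divr_ge0 ?ler0n // (ler_pdivrMr _ _ tR).
  rewrite /q mulrA mulrAC (ler_pdivlMr _ _ wR) -!natrM ler_nat.
  have nN : (n <= N)%N by exact: leq_pmulr.
  by have := leq_mul nN wt; lia.
rewrite -(ler_nat rat); apply: le_trans binN; clearbody q.
rewrite natrM natrX expnMn natrM !natrX.
apply: (@le_trans _ _
  (4%:R ^+ (5 * t) * ((20%:R * q) ^+ t) ^+ 2 * 2%:R ^+ (t * D) ^+ 2)).
  rewrite -mulrA ler_pM ?ler_pM ?exprn_ge0 ?mulr_ge0 ?exprn_ge0 ?ler0n //.
  by apply: ler_weXn2l; rewrite ?ler1n.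
have E (x y z : rat) : x ^+ (5 * t) * y ^+ t ^+ 2 * z ^+ (t * D) ^+ 2
    = (x ^+ 5 * y ^+ 2 * z ^+ 2 ^+ D) ^+ t.
  rewrite 2!exprMn -!exprM (mulnC t 2%N) (mulnC (t * D)%N).
  by rewrite [(t * D)%N]mulnC mulnA.
rewrite E [q ^+ _]exprM.
have -> : 4 ^+ 5 * (20 * q) ^+ 2 * 2 ^+ 2 ^+ D = M%:R * q ^+ 2.
  rewrite ME natrM natrX exprD (_ : 2 ^+ 2 = 4 :> rat); last by ring.
  ring.
have Mq0 : 0 <= M%:R * q ^+ 2 by rewrite mulr_ge0 ?exprn_ge0 ?ler0n.
rewrite lerXn2r ?nnegrE ?Mq0 ?exprn_ge0 // (exprS q 2).
by rewrite ler_wpM2r ?exprn_ge0.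
Qed.

(** * Union bound over the weights *)

(** The series of [4 ^- w.+1] sums to 1/3; the induction keeps the exact partial sum, hence the
    factor [1 - 4^-1 ^+ m]. *)
Lemma sum_leq_of_geometric (K m : nat) (f : nat -> nat) :
  (forall w, 4 ^ w.+1 * f w <= K)%N -> (3 * (\sum_(w < m) f w) <= K)%N.
Proof.
move=> fK; have E : (\sum_(w < m) f w)%:R * 3 <= (K%:R : rat) * (1 - 4^-1 ^+ m).
  elim: m => [|m IH]; first by rewrite big_ord0 expr0 subrr mulr0 mul0r.
  rewrite big_ord_recr natrD mulrDl /=.
  have : (f m)%:R <= (K%:R : rat) * 4^-1 ^+ m.+1.
    by rewrite exprVn ler_pdivlMr ?exprn_gt0 // -natrX -natrM ler_nat mulnC fK.
  move: IH; rewrite exprS; lra.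
rewrite -(ler_nat rat) natrM mulrC; apply: le_trans E _.
by rewrite ler_piMr // gerBl exprn_ge0 ?invr_ge0.
Qed.

(* The permutations carrying the support of a putative light code word, as seen
   from V_1, to its support as seen from V_0. *)
Definition bad_perms (T V : finType) (p : T -> V) (M : nat) : {set {perm T}} :=
  [set s : {perm T} | [exists X : {set T},
    [&& X != set0, (M * #|X| <= #|T|)%N, X \in block_supports T V p #|X|
      & s @: X \in block_supports T V p #|X|]]].

Lemma card_bad_perms (T V : finType) (p : T -> V) (D M : nat) :
  (0 < D)%N -> (forall v, #|p @^-1: [set v]| = D) ->
  #|T| = (#|V| * D)%N -> M = (400 * 4 ^ (D + 5))%N ->
  (3 * #|bad_perms T V p M| <= #|T|`!)%N.
Proof.
move=> D0 pD cT ME; set N := #|T|.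
pose F := block_supports T V p.
pose hits w := [set s : {perm T} | [exists X in F w, s @: X \in F w]].
have sub : bad_perms T V p M \subset \bigcup_(w < N | (M * w.+1 <= N)%N) hits w.+1.
  apply/subsetP => s; rewrite inE => /existsP[X /and4P[X0 XM XF sXF]].
  have Xgt0 : (0 < #|X|)%N by rewrite card_gt0.
  have Xlt : (#|X|.-1 < N)%N by rewrite prednK // max_card.
  apply/bigcupP; exists (Ordinal Xlt) => /=; rewrite ?prednK //.
  by rewrite inE; apply/existsP; exists X; rewrite XF.
(* The index is shifted to start at weight 1; the value 0 beyond [N / M] makes the geometric bound
   hold for every [w]. *)
pose f w := if (M * w.+1 <= N)%N then #|hits w.+1| else 0%N.
have fK w : (4 ^ w.+1 * f w <= N`!)%N.
  rewrite /f; case: ifP => [Mw|]; last by rewrite muln0.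
  have [w3|w3] := leqP 3 w.+1; last first.
    suff -> : hits w.+1 = set0 by rewrite cards0 muln0.
    apply/setP => s; rewrite !inE; apply/existsP => -[X].
    by rewrite /F block_supports_small // inE.
  have M1 : (12 <= M)%N by rewrite ME expnD; have := expn_gt0 4 D; lia.
  have wN : (w.+1 <= N)%N by apply: leq_trans Mw; apply: leq_pmull; lia.
  have C0 : (0 < 'C(N, w.+1))%N by rewrite bin_gt0.
  rewrite -(leq_pmul2r C0) -mulnA.
  have FE : {in F w.+1, forall X : {set T}, #|X| = w.+1}.
    by move=> X; rewrite inE => /andP[/eqP].
  apply: leq_trans (leq_mul (leqnn _) (card_perm_hits T (F w.+1) w.+1 FE)) _.
  rewrite mulnA mulnC leq_mul //.
  have Mw' : (M * w.+1 <= #|V| * D)%N by rewrite -cT.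
  rewrite /N cT.
  apply: leq_trans (card_block_supports_sq_leq_bin _ D _ M ME w3 D0 Mw').
  rewrite leq_mul // leq_exp2r // card_block_supports //.
  (* Room for the padding: [D <= M] turns [M * w.+1 <= #|V| * D] into [w.+1 <= #|V|]. *)
  apply: leq_trans (leq_div _ _) _.
  have DM : (D <= M)%N.
    by rewrite ME; apply: leq_trans (ltnW (ltn_expl D (isT : (1 < 4)%N))) _;
      rewrite expnD mulnCA leq_pmulr.
  have M0 : (0 < M)%N by exact: leq_trans M1.
  by rewrite -(leq_pmul2l M0); have := leq_mul (leqnn #|V|) DM; lia.
apply: leq_trans (sum_leq_of_geometric _ N f fK); rewrite leq_mul //.
apply: leq_trans (subset_leq_card sub) _.
apply: leq_trans (leq_card_bigcup _ _ _ _) _.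
by rewrite big_mkcond.
Qed.

(** * From code words to supports *)

Lemma local_weight (m D : nat) (H : 'M['F_2]_(m, D)) (a : 'rV['F_2]_D) :
  a \in local_code H -> a != 0 ->
  (min_dist (local_code H) <= #|[set i | a 0%R i != 0%R]|)%N.
Proof.
move=> aH a0; have H0 : (0 : 'rV_D) \in local_code H.
  by rewrite inE trmx0 mulmx0.
rewrite /min_dist -minEnat -leEnat.
apply: le_trans (@bigmin_le_cond _ _ _ _ (a, 0) _ _ _) _.
  by rewrite inE aH H0.
rewrite leEnat; apply: eq_leq; apply: eq_card => i.
by rewrite !inE mxE.
Qed.

Lemma graph_codeB (m n D : nat) (H : 'M['F_2]_(m, D)) (pi : 'S_(n * D)) x y :
  x \in graph_code H pi -> y \in graph_code H pi -> x - y \in graph_code H pi.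
Proof.
rewrite !graph_code_parity_check !inE => /eqP xH /eqP yH.
by rewrite linearB /= mulmxBr xH yH subrr.
Qed.

(** The end of [e] in V_0. Its end in V_1 is [left_end] of the preimage of [e] under [pi], so one
    map serves both sides. *)
Definition left_end (n D : nat) (e : 'I_(n * D)) : 'I_n := (mxtens_unindex e).1.

Lemma card_left_end_preimset (n D : nat) (v : 'I_n) (P : pred 'I_(n * D)) :
  #|[set e | P e] :&: left_end n D @^-1: [set v]|
    = #|[set i : 'I_D | P (mxtens_index (v, i))]|.
Proof.
have inj : injective (fun i : 'I_D => mxtens_index (v, i)).
  by move=> i j /(can_inj (@mxtens_indexK _ _))[].
rewrite -(card_imset _ inj); apply: eq_card => e; rewrite !inE.
apply/andP/imsetP => [[Pe /eqP ev]|[i]].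
  have eE : e = mxtens_index (v, (mxtens_unindex e).2).
    by rewrite -ev -surjective_pairing mxtens_unindexK.
  by exists (mxtens_unindex e).2; rewrite // inE -eE.
by rewrite inE => Pi ->; rewrite /left_end mxtens_indexK.
Qed.

(** For [s = true] the support is pulled back along [pi], which turns the edges at a vertex of V_1
    into a block. On either side a block carries a local code word, which is zero or has weight at
    least 3. *)
Lemma graph_code_block_supports (m n D : nat) (H : 'M['F_2]_(m, D))
    (pi : 'S_(n * D)) (x : 'rV['F_2]_(n * D)) (s : bool)
    (X := [set e | x 0 (if s then pi e else e) != 0]) :
  (3 <= min_dist (local_code H))%N -> x \in graph_code H pi ->
  X \in block_supports 'I_(n * D) 'I_n (left_end n D) #|X|.
Proof.
move=> H3; rewrite inE => /forallP/(_ s)/forallP xH; rewrite inE eqxx /=.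
apply/forallP => v; set a := vertex_proj (perm_incidence pi) s v x.
have -> : #|X :&: left_end n D @^-1: [set v]| = #|[set i | a 0 i != 0]|.
  rewrite card_left_end_preimset; apply: eq_card => i.
  by rewrite !inE mxE; case: (s).
have [->|a0] := eqVneq a 0.
  by apply/orP; left; rewrite cards_eq0; apply/eqP/setP => i;
    rewrite !inE mxE eqxx.
by apply/orP; right; apply: leq_trans H3 (local_weight _ _ _ _ (xH v) a0).
Qed.

(** By linearity, two distinct words at distance below [n * D / M] differ by a light nonzero word,
    whose supports seen from V_1 and V_0 would make [pi] bad. *)
Lemma graph_code_rel_dist (m n D M : nat) (H : 'M['F_2]_(m, D)) (pi : 'S_(n * D)) :
  (0 < n * D)%N -> (0 < M)%N -> (3 <= min_dist (local_code H))%N ->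
  pi \notin bad_perms 'I_(n * D) 'I_n (left_end n D) M ->
  M%:R^-1 <= rel_dist (graph_code H pi).
Proof.
move=> N0 M0 H3 good; rewrite /rel_dist ler_pdivlMr ?ltr0n // mulrC.
rewrite ler_pdivrMr ?ltr0n // -natrM ler_nat (mulnC _ M).
(* The default value of the minimum is the length [n * D], which satisfies the bound since
   [0 < M]. *)
rewrite /min_dist; elim/big_rec: _ => [|[x y] k]; first by rewrite leq_pmull.
rewrite inE /= => /andP[/andP[xC yC] xy] le; rewrite /minn; case: ifP => // _.
have zC := graph_codeB _ _ _ _ _ _ _ xC yC.
pose X (s : bool) := [set e | (x - y) 0 (if s then pi e else e) != 0].
have piX : pi @: X true = X false.
  apply/setP => e; rewrite inE; apply/imsetP/idP => [[f]|xe].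
    by rewrite inE => xf ->.
  by exists ((pi^-1)%g e); rewrite ?inE permKV.
have cX : #|X true| = #|X false| by rewrite -piX card_imset //; exact: perm_inj.
have -> : hamming_dist x y = #|X true|.
  by rewrite cX; apply: eq_card => e; rewrite !inE !mxE subr_eq0.
rewrite leqNgt; apply: contra good => lt; rewrite inE; apply/existsP.
have bs s : X s \in block_supports _ _ (left_end n D) #|X s|.
  exact: (graph_code_block_supports m n D H pi (x - y) s H3 zC).
exists (X true); apply/and4P; split;
  [|by rewrite card_ord ltnW|exact: bs|by rewrite piX cX; exact: bs].
apply: contraNneq xy => X0; rewrite -subr_eq0; apply/eqP/rowP => e.
apply/eqP; have /setP/(_ ((pi^-1)%g e)) := X0.
by rewrite !inE permKV !mxE => /negbFE.
Qed.

(** * Averaging over the ensemble *)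

Theorem corollary4 (D k : nat) (hk : (k <= D)%N)
    (hA : local_checks D k 3 != set0) :
  exists2 delta : rat, 0 < delta &
    exists n0 : nat, forall n : nat, (n0 <= n)%N ->
      delta <= ensemble_avg_rel_dist D k 3 n /\
      exists2 w : 'M['F_2]_(D - k, D) * 'S_(n * D),
        w \in ensemble D k 3 n & delta <= rel_dist (graph_code w.1 w.2).
Proof.
(* The default value in [min_dist] is [D], so a local distance of at least 3 forces [3 <= D]. *)
have D0 : (0 < D)%N.
  have /set0Pn[H] := hA; rewrite inE => /andP[_ H3].
  rewrite (@leq_trans (min_dist (local_code H))) //; first exact: leq_trans H3.
  by rewrite /min_dist -minEnat -leEnat; exact: bigmin_le_id.
(* [M] is a variable known only through [ME], so this large natural number cannot be unfolded. *)
pose M0 := (400 * 4 ^ (D + 5))%N; have [M ME] : {M | M = M0} by exists M0.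
have Mgt0 : (0 < M)%N by rewrite ME muln_gt0 expn_gt0.
have MR : (0 : rat) < M%:R by rewrite ltr0n.
(* At least 2/3 of the permutations contribute [1 / M] or more, the others at least 0. *)
pose delta : rat := 2 / 3 / M%:R.
have delta0 : 0 < delta by rewrite !divr_gt0.
exists delta => //; exists 1%N => n n0.
have N0 : (0 < n * D)%N by rewrite muln_gt0 n0.
have E0 : (0 < #|ensemble D k 3 n|)%N.
  by rewrite cardsX muln_gt0 card_gt0 hA cardsT; apply/card_gt0P; exists 1%g.
have avg : delta <= ensemble_avg_rel_dist D k 3 n.
  rewrite /ensemble_avg_rel_dist ler_pdivlMr ?ltr0n // cardsX natrM.
  rewrite (eq_bigl (fun w => (w.1 \in local_checks D k 3) && predT w.2)); last first.
    by move=> w; rewrite !inE.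
  rewrite -(pair_big (mem (local_checks D k 3)) predT
    (fun H pi => rel_dist (graph_code H pi))) /=.
  (* The bound is proved for each [H] separately, averaging over [pi] alone. *)
  rewrite mulrCA mulr_natl -sumr_const; apply: ler_sum => H.
  rewrite inE => /andP[_ H3].
  pose bad := bad_perms 'I_(n * D) 'I_n (left_end n D) M.
  have rel0 (C : {set 'rV['F_2]_(n * D)}) : 0 <= rel_dist C by rewrite divr_ge0.
  rewrite (bigID (mem bad)) /=; apply: ler_wpDl; first by apply: sumr_ge0.
  apply: (@le_trans _ _ (\sum_(pi in ~: bad) M%:R^-1)); last first.
    rewrite [X in _ <= X](eq_bigl (mem (~: bad))); last by move=> pi; rewrite !inE.
    apply: ler_sum => pi; rewrite inE => good.
    exact: graph_code_rel_dist good.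
  rewrite sumr_const -[X in _ <= X]mulr_natl /delta mulrAC ler_pM2r ?invr_gt0 //.
  have fib v : #|left_end n D @^-1: [set v]| = D.
    have <- : [set e | predT e] :&: left_end n D @^-1: [set v]
        = left_end n D @^-1: [set v] by apply/setP => e; rewrite !inE.
    by rewrite card_left_end_preimset cardsT card_ord.
  have cT : #|'I_(n * D)| = (#|'I_n| * D)%N by rewrite !card_ord.
  have := card_bad_perms _ _ _ D M D0 fib cT ME.
  have cP : (#|[set: 'S_(n * D)]| = #|bad| + #|~: bad|)%N.
    by rewrite cardsT cardsC.
  rewrite -/bad -card_Sym (cP : #|('Sym_('I_(n * D)))%g| = _).
  rewrite -(ler_nat rat) natrM !natrD; lra.
split=> //.
(* If every member were below [delta], the average over the nonempty ensemble would be strictly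
   below it. *)
have [/exists_inP //|/exists_inPn small] :=
  boolP [exists w in ensemble D k 3 n, delta <= rel_dist (graph_code w.1 w.2)].
move: avg; rewrite leNgt => /negP[].
rewrite ltr_pdivrMr ?ltr0n // mulr_natr -sumr_const; apply: ltr_sum.
  by have /card_gt0P[w wE] := E0; apply/hasP; exists w; rewrite ?mem_index_enum.
by move=> w /small; rewrite -ltNge.
Qed.
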